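(* Let $k$ be a field, let $V$ be a $k$-vector space with $\dim V=2$, let $B$ be an arbitrary bilinear form on $V$ (scalar product) and let $C\in V\otimes V$ be an arbitrary co-scalar product. Consider the Clifford biconvolution $C\ell(B,C)$ on $\bigwedge V$, with product $\&c$ (depending on $B$) and co-product $\Delta_C$ (depending on $C$). Then: (1) there is no non-trivial (i.e. non-zero) integral, neither left nor right, for $C\ell(B,C)$ unless $C=0$; (2) there is no non-trivial (i.e. non-zero) cointegral, neither left nor right, for $C\ell(B,C)$ unless $B=0$.
   Context: Grassmann structure: $\bigwedge V$ carries the exterior product $\wedge$ with unit $\mathrm{Id}=1$ (unit map $\eta$), and the Grassmann co-product $\Delta(x)=x_{(1)}\otimes x_{(2)}$ (Sweedler notation), the algebra homomorphism into the graded tensor product $\bigwedge V\hat\otimes\bigwedge V$ with $\Delta(v)=v\otimes 1+1\otimes v$ for $v\in V$. The counit $\epsilon:\bigwedge V\to k$ is the projection onto the coefficient of $1$. Clifford product: $B$ is extended to $B^{\wedge}:\bigwedge V\times\bigwedge V\to k$ by $B^\wedge(1,1)=1$, $B^{\wedge}(x_1\wedge\cdots\wedge x_r,\,y_1\wedge\cdots\wedge y_r)=(-1)^{r(r-1)/2}\det[B(x_i,y_j)]$ for $x_i,y_j\in V$, and $B^\wedge=0$ on pairs of elements of different grades. The product of $C\ell(B,C)$ is $x\,\&c\,y=B^{\wedge}(x_{(2)},y_{(1)})\,x_{(1)}\wedge y_{(2)}$, where $x_{(i)},y_{(i)}$ refer to the Grassmann co-product; its unit is $1$. Clifford co-product: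 in a basis $e_1,e_2$ of $V$ write $C=u\,e_1\otimes e_1+z\,e_1\otimes e_2+w\,e_2\otimes e_1+v\,e_2\otimes e_2$. Put $C^{\wedge}=C^\wedge_{(1)}\otimes C^\wedge_{(2)}=1\otimes 1+C+(zw-uv)\,(e_1\wedge e_2)\otimes(e_1\wedge e_2)$. The co-product of $C\ell(B,C)$ is $\Delta_C(x)=(x_{(1)}\wedge C^\wedge_{(1)})\otimes(C^\wedge_{(2)}\wedge x_{(2)})$, with counit $\epsilon$. A right integral is a linear form $\mu_R:\bigwedge V\to k$ with $(\mathrm{id}\otimes\mu_R)\Delta_C(x)=\mu_R(x)\,1$ for all $x$; a left integral is a linear form $\mu_L$ with $(\mu_L\otimes\mathrm{id})\Delta_C(x)=\mu_L(x)\,1$ for all $x$. A right cointegral is an element $e_R\in\bigwedge V$ with $x\,\&c\,e_R=\epsilon(x)\,e_R$ for all $x$; a left cointegral is an element $e_L$ with $e_L\,\&c\,x=\epsilon(x)\,e_L$ for all $x$. *)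

(* Defs.v *)
From HB Require Import structures.
From mathcomp Require Import all_boot all_order all_algebra.
From mathcomp Require Import ring.

Set Implicit Arguments.
Unset Strict Implicit.
Unset Printing Implicit Defensive.

Import GRing.Theory.
Local Open Scope ring_scope.

(* Vectors of a finite-dimensional space are given by their coordinates on a  *)
(* basis indexed by a finite type T: [delta a] is the basis vector of index   *)
(* a, [linext F] the linear map sending [delta a] to [F a], and [twmul c u]   *)
(* the bilinear product with [delta a * delta b = c a b *: delta (u a b)].    *)
Section Coordinates.
Variables (k : fieldType) (T : finType).
Implicit Types (x y : {ffun T -> k^o}) (a b : T).

Definition delta a : {ffun T -> k^o} := [ffun b => (b == a)%:R].

Definition linext (W : lmodType k) (F : T -> W) x : W := \sum_a x a *: F a.

Definition twmul (c : T -> T -> k) (u : T -> T -> T) x y : {ffun T -> k^o} :=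
  \sum_a \sum_b (x a * y b * c a b) *: delta (u a b).

End Coordinates.

Section GrassmannAlgebra.
Variables (k : fieldType) (n : nat).

(* For a space V with basis e_0, ..., e_(n-1), [delta I] stands for           *)
(* e_i1 /\ ... /\ e_ir, where I = {i1 < ... < ir}.                            *)
Definition exterior := {ffun {set 'I_n} -> k^o}.

Definition inversions (I J : {set 'I_n}) : nat :=
  \sum_(i in I) \sum_(j in J) (j < i)%N.

Definition wedge_coef (I J : {set 'I_n}) : k :=
  if [disjoint I & J] then (-1) ^+ inversions I J else 0.

Definition wedge : exterior -> exterior -> exterior :=
  twmul wedge_coef (fun I J => I :|: J).

Definition ext1 : exterior := delta k set0.

Definition gen (i : 'I_n) : exterior := delta k [set i].

Definition counit (x : exterior) : k := x set0.

(* The tensor square of the exterior algebra: [delta (I, J)] stands for       *)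
(* [delta I] (x) [delta J].                                                   *)
Definition exterior2 := {ffun {set 'I_n} * {set 'I_n} -> k^o}.

Definition tens (x y : exterior) : exterior2 := [ffun p => x p.1 * y p.2].

(* Graded tensor product: (a (x) b)(c (x) d) = (-1)^(|b||c|) (ac (x) bd).     *)
Definition gmul_coef (p q : {set 'I_n} * {set 'I_n}) : k :=
  (-1) ^+ (#|p.2| * #|q.1|) * (wedge_coef p.1 q.1 * wedge_coef p.2 q.2).

Definition gmul : exterior2 -> exterior2 -> exterior2 :=
  twmul gmul_coef (fun p q => (p.1 :|: q.1, p.2 :|: q.2)).

(* The algebra morphism to (exterior2, gmul) sending each generator g to      *)
(* g (x) 1 + 1 (x) g: [delta I] is the increasing product of its generators.  *)
Definition coproduct : exterior -> exterior2 :=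
  linext (fun I : {set 'I_n} =>
    \big[gmul/tens ext1 ext1]_(i <- enum I) (tens (gen i) ext1 + tens ext1 (gen i))).

Definition id_tens (mu : exterior -> k) : exterior2 -> exterior :=
  linext (fun p => mu (delta k p.2) *: (delta k p.1 : exterior)).

Definition tens_id (mu : exterior -> k) : exterior2 -> exterior :=
  linext (fun p => mu (delta k p.1) *: (delta k p.2 : exterior)).

End GrassmannAlgebra.

Arguments ext1 {k n}.
Arguments gen {k n} i.

Section CliffordProduct.
Variables (k : fieldType) (V : vectType k) (n : nat) (e : n.-tuple V).
Variable B : {biscalar V}.

Definition embed (v : V) : exterior k n := \sum_i coord e i v *: (gen i : exterior k n).

(* The value of B^ on (x_1 /\ ... /\ x_r, y_1 /\ ... /\ y_s). *)
Definition Bwedge_dec (xs ys : seq V) : k :=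
  if size xs == size ys then
    (-1) ^+ ((size xs * (size xs).-1) %/ 2) *
      \det (\matrix_(i < size xs, j < size xs) B (nth 0 xs i) (nth 0 ys j))
  else 0.

Definition basis_seq (I : {set 'I_n}) : seq V := [seq tnth e i | i in I].

Definition Bwedge (x y : exterior k n) : k :=
  \sum_I \sum_J x I * y J * Bwedge_dec (basis_seq I) (basis_seq J).

Definition clifford_mul (x y : exterior k n) : exterior k n :=
  \sum_p \sum_q (coproduct x p * coproduct y q
                   * Bwedge (delta k p.2) (delta k q.1))
    *: (wedge (delta k p.1) (delta k q.2) : exterior k n).

Definition right_cointegral (c : exterior k n) :=
  forall x, clifford_mul x c = counit x *: c.

Definition left_cointegral (c : exterior k n) :=
  forall x, clifford_mul c x = counit x *: c.

End CliffordProduct.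

(* C i j is the coefficient of e_i (x) e_j in the co-scalar product, so that   *)
(* u, z, w, v are C 0 0, C 0 1, C 1 0, C 1 1.                                 *)
Section CliffordCoproduct.
Variables (k : fieldType) (C : 'M[k]_2).

Let i0 : 'I_2 := ord0.
Let i1 : 'I_2 := ord_max.

Definition Cwedge : exterior2 k 2 :=
  tens ext1 ext1 + \sum_i \sum_j C i j *: (tens (gen i) (gen j) : exterior2 k 2)
  + (C i0 i1 * C i1 i0 - C i0 i0 * C i1 i1)
      *: (tens (wedge (gen i0) (gen i1)) (wedge (gen i0) (gen i1)) : exterior2 k 2).

Definition clifford_coproduct (x : exterior k 2) : exterior2 k 2 :=
  \sum_p \sum_q (coproduct x p * Cwedge q)
    *: (tens (wedge (delta k p.1) (delta k q.1))
             (wedge (delta k q.2) (delta k p.2)) : exterior2 k 2).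

Definition right_integral (mu : exterior k 2 -> k) :=
  forall x, id_tens mu (clifford_coproduct x) = mu x *: ext1.

Definition left_integral (mu : exterior k 2 -> k) :=
  forall x, tens_id mu (clifford_coproduct x) = mu x *: ext1.

End CliffordCoproduct.

(* Consistency of these formulas with their basis-free characterizations:     *)
(* [wedge] and [gmul] are associative and unital, [embed v] squares to zero,  *)
(* [coproduct] is an algebra morphism with v |-> v (x) 1 + 1 (x) v, and       *)
(* [Bwedge] has the prescribed values on all products of vectors.             *)
Module GrassmannFacts.

Section Coordinates.
Variables (k : fieldType) (T : finType).
Implicit Types (x y : {ffun T -> k^o}) (a b : T).

Lemma linext_is_linear (W : lmodType k) (F : T -> W) : linear (linext F).
Proof.
move=> a x y; rewrite /linext scaler_sumr -big_split; apply: eq_bigr => i _.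
by rewrite !ffunE scalerDl scalerA.
Qed.
HB.instance Definition _ (W : lmodType k) (F : T -> W) :=
  GRing.isLinear.Build k {ffun T -> k^o} W _ (linext F) (linext_is_linear F).

Lemma linext_delta (W : lmodType k) (F : T -> W) a : linext F (delta k a) = F a.
Proof.
rewrite /linext (bigD1 a) //= big1 ?addr0 ?ffunE ?eqxx ?scale1r // => b /negPf ba.
by rewrite ffunE ba scale0r.
Qed.

Lemma linext_id x : linext (@delta k T) x = x.
Proof.
apply/ffunP => b; rewrite /linext sum_ffunE (bigD1 b) //= big1 => [|a ab].
  by rewrite addr0 !ffunE eqxx [_ *: _]mulr1.
by rewrite !ffunE eq_sym (negPf ab) [_ *: _]mulr0.
Qed.

Lemma ffun_lin_ind (P : {ffun T -> k^o} -> Prop) :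
  P 0 -> (forall c x y, P x -> P y -> P (c *: x + y)) ->
  (forall a, P (delta k a)) -> forall x, P x.
Proof.
move=> P0 PL Pd x; rewrite -[x]linext_id /linext.
apply: (big_ind P) => // [y z Py Pz|a _]; first by rewrite -[y]scale1r; apply: PL.
by rewrite -[_ *: _]addr0; apply: PL.
Qed.

Variables (c : T -> T -> k) (u : T -> T -> T).

Lemma twmulE x y : twmul c u x y =
  linext (fun a => linext (fun b => c a b *: delta k (u a b)) y) x.
Proof.
rewrite /twmul /linext; apply: eq_bigr => a _; rewrite scaler_sumr.
by apply: eq_bigr => b _; rewrite !scalerA.
Qed.

Lemma twmulPl z s x y :
  twmul c u (s *: x + y) z = s *: twmul c u x z + twmul c u y z.
Proof. by rewrite !twmulE linearP. Qed.

Lemma twmulPr z s x y :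
  twmul c u z (s *: x + y) = s *: twmul c u z x + twmul c u z y.
Proof.
rewrite !twmulE /linext scaler_sumr -big_split; apply: eq_bigr => a _.
rewrite -/(linext _ (s *: x + y)) linearP scalerDr !scalerA; congr (_ + _).
by rewrite mulrC.
Qed.

Lemma twmul0l z : twmul c u 0 z = 0. Proof. by rewrite twmulE linear0. Qed.
Lemma twmul0r z : twmul c u z 0 = 0.
Proof.
by rewrite twmulE /linext big1 // => a _; rewrite -/(linext _ _) linear0 scaler0.
Qed.

Lemma twmul_delta a b : twmul c u (delta k a) (delta k b) = c a b *: delta k (u a b).
Proof. by rewrite twmulE !linext_delta. Qed.

Lemma twmulZl s x z : twmul c u (s *: x) z = s *: twmul c u x z.
Proof. by rewrite -[s *: x]addr0 twmulPl twmul0l addr0. Qed.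
Lemma twmulZr s x z : twmul c u z (s *: x) = s *: twmul c u z x.
Proof. by rewrite -[s *: x]addr0 twmulPr twmul0r addr0. Qed.

Lemma twmulA : (forall a b d, c a b * c (u a b) d = c b d * c a (u b d)) ->
  associative u -> associative (twmul c u).
Proof.
move=> cA uA x y z.
elim/ffun_lin_ind: x => [|s x x' IH IH'|a]; first by rewrite !twmul0l.
  by rewrite !twmulPl IH IH'.
elim/ffun_lin_ind: y => [|s x x' IH IH'|b]; first by rewrite !(twmul0l,twmul0r).
  by rewrite !(twmulPl, twmulPr) IH IH'.
elim/ffun_lin_ind: z => [|s x x' IH IH'|d]; first by rewrite !twmul0r.
  by rewrite !twmulPr IH IH'.
by rewrite !(twmul_delta, twmulZl, twmulZr) !scalerA cA uA.
Qed.

Lemma twmul1 a : (forall b, c a b = 1) -> (forall b, u a b = b) ->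
  left_id (delta k a) (twmul c u).
Proof.
move=> c1 u1 x; elim/ffun_lin_ind: x => [|s x x' IH IH'|b].
- by rewrite twmul0r. - by rewrite twmulPr IH IH'.
by rewrite twmul_delta c1 u1 scale1r.
Qed.
Lemma twmulr1 a : (forall b, c b a = 1) -> (forall b, u b a = b) ->
  right_id (delta k a) (twmul c u).
Proof.
move=> c1 u1 x; elim/ffun_lin_ind: x => [|s x x' IH IH'|b].
- by rewrite twmul0l. - by rewrite twmulPl IH IH'.
by rewrite twmul_delta c1 u1 scale1r.
Qed.
End Coordinates.

Section Products.
Variables (k : fieldType) (n : nat).
Implicit Types (I J K : {set 'I_n}).

Lemma inversionsUl I J K : [disjoint I & J] ->
  inversions (I :|: J) K = (inversions I K + inversions J K)%N.
Proof. by move=> d; rewrite /inversions -bigU //=; apply: eq_bigl => i; rewrite inE. Qed.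
Lemma inversionsUr I J K : [disjoint J & K] ->
  inversions I (J :|: K) = (inversions I J + inversions I K)%N.
Proof.
move=> d; rewrite /inversions -big_split; apply: eq_bigr => i _ /=.
by rewrite -bigU //=; apply: eq_bigl => j; rewrite inE.
Qed.
Lemma inversions0l J : inversions set0 J = 0%N. Proof. by rewrite /inversions big_set0. Qed.
Lemma inversions0r J : inversions J set0 = 0%N.
Proof. by rewrite /inversions big1 // => i _; rewrite big_set0. Qed.

Lemma wedge_coefA I J K : wedge_coef k I J * wedge_coef k (I :|: J) K =
  wedge_coef k J K * wedge_coef k I (J :|: K).
Proof.
rewrite /wedge_coef.
have -> : [disjoint I :|: J & K] = [disjoint I & K] && [disjoint J & K].
  by rewrite -!setI_eq0 setIUl setU_eq0.
have -> : [disjoint I & J :|: K] = [disjoint I & J] && [disjoint I & K].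
  by rewrite -!setI_eq0 setIUr setU_eq0.
case dIJ: [disjoint I & J]; case dIK : [disjoint I & K]; case dJK: [disjoint J & K];
  rewrite /= ?mul0r ?mulr0 //.
by rewrite inversionsUl // inversionsUr // !exprD; ring.
Qed.
Lemma wedge_coef0l J : wedge_coef k set0 J = 1.
Proof. by rewrite /wedge_coef inversions0l -setI_eq0 set0I eqxx. Qed.
Lemma wedge_coef0r J : wedge_coef k J set0 = 1.
Proof. by rewrite /wedge_coef inversions0r -setI_eq0 setI0 eqxx. Qed.

Lemma wedgeA : associative (@wedge k n).
Proof. by apply: twmulA => [I J K|]; [apply: wedge_coefA|apply: setUA]. Qed.
Lemma wedge1x : left_id ext1 (@wedge k n).
Proof. by apply: twmul1 => J; [apply: wedge_coef0l | apply: set0U]. Qed.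
Lemma wedgex1 : right_id ext1 (@wedge k n).
Proof. by apply: twmulr1 => J; [apply: wedge_coef0r | apply: setU0]. Qed.
HB.instance Definition _ := Monoid.isLaw.Build (exterior k n) ext1 (@wedge k n)
  wedgeA wedge1x wedgex1.

Lemma gmul_coefA (p q r : {set 'I_n} * {set 'I_n}) :
  gmul_coef k p q * gmul_coef k (p.1 :|: q.1, p.2 :|: q.2) r =
  gmul_coef k q r * gmul_coef k p (q.1 :|: r.1, q.2 :|: r.2).
Proof.
rewrite /gmul_coef /=.
have W1 := wedge_coefA p.1 q.1 r.1; have W2 := wedge_coefA p.2 q.2 r.2.
case d2: [disjoint p.2 & q.2]; last first.
  have z: wedge_coef k p.2 q.2 = 0 by rewrite /wedge_coef d2.
  rewrite z mul0r in W2; rewrite z; rewrite !(mulr0, mul0r).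
  transitivity ((-1) ^+ (#|q.2| * #|r.1|) * wedge_coef k q.1 r.1 *
    ((-1) ^+ (#|p.2| * #|q.1 :|: r.1|) * wedge_coef k p.1 (q.1 :|: r.1)) *
   (wedge_coef k q.2 r.2 * wedge_coef k p.2 (q.2 :|: r.2))); last by ring.
  by rewrite -W2 mulr0.
case d1: [disjoint q.1 & r.1]; last first.
  have z: wedge_coef k q.1 r.1 = 0 by rewrite /wedge_coef d1.
  rewrite z mul0r in W1; rewrite z; rewrite !(mulr0, mul0r).
  transitivity ((-1) ^+ (#|p.2| * #|q.1|) * wedge_coef k p.2 q.2 *
    ((-1) ^+ (#|p.2 :|: q.2| * #|r.1|) * wedge_coef k (p.2:|:q.2) r.2) *
   (wedge_coef k p.1 q.1 * wedge_coef k (p.1 :|: q.1) r.1)); first by ring.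
  by rewrite W1 mulr0.
have -> : #|p.2 :|: q.2| = (#|p.2| + #|q.2|)%N.
  by rewrite cardsU (disjoint_setI0 d2) cards0 subn0.
have -> : #|q.1 :|: r.1| = (#|q.1| + #|r.1|)%N.
  by rewrite cardsU (disjoint_setI0 d1) cards0 subn0.
rewrite mulnDl mulnDr !exprD.
move: W1 W2.
set a1 := wedge_coef k p.1 _; set a2 := wedge_coef k (_ :|: _) _.
set a3 := wedge_coef k q.1 _; set a4 := wedge_coef k p.1 _.
set b1 := wedge_coef k p.2 _; set b2 := wedge_coef k (_ :|: _) _.
set b3 := wedge_coef k q.2 _; set b4 := wedge_coef k p.2 _.
move=> W1 W2.
set s1 := _ ^+ _; set s2 := _ ^+ _; set s3 := _ ^+ _.
transitivity (s1 * s2 * s3 * (a1 * a2) * (b1 * b2)); first by ring.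
by rewrite W1 W2; ring.
Qed.

Notation one2 := (tens ext1 ext1 : exterior2 k n).
Lemma tens_delta I J : tens (delta k I) (delta k J) = delta k (I, J).
Proof. by apply/ffunP => -[A D]; rewrite !ffunE /= xpair_eqE -natrM mulnb. Qed.
Lemma gmulA : associative (@gmul k n).
Proof.
by apply: twmulA => [I J K|p q r]; [apply: gmul_coefA|rewrite /= !setUA].
Qed.
Lemma gmul1x : left_id one2 (@gmul k n).
Proof.
rewrite /ext1 tens_delta; apply: twmul1 => -[I J] /=; last by rewrite !set0U.
by rewrite /gmul_coef /= !wedge_coef0l cards0 mul0n expr0 !mul1r.
Qed.
Lemma gmulx1 : right_id one2 (@gmul k n).
Proof.
rewrite /ext1 tens_delta; apply: twmulr1 => -[I J] /=; last by rewrite !setU0.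
by rewrite /gmul_coef /= !wedge_coef0r cards0 muln0 expr0 !mul1r.
Qed.
HB.instance Definition _ := Monoid.isLaw.Build (exterior2 k n) one2 (@gmul k n)
  gmulA gmul1x gmulx1.
End Products.

Section SortedEnum.
Variable n : nat.
Implicit Types J : {set 'I_n}.
Definition lt_ord := [rel i j : 'I_n | (i < j)%N].
Lemma lt_tr : transitive lt_ord. Proof. by move=> a b d /=; apply: ltn_trans. Qed.
Lemma lt_irr : irreflexive lt_ord. Proof. by move=> a /=; rewrite ltnn. Qed.
Lemma sorted_enum J : sorted lt_ord (enum J).
Proof.
rewrite /enum_mem; apply: (sorted_filter lt_tr).
rewrite -enumT; have := iota_ltn_sorted 0 n.
by rewrite -val_enum_ord sorted_map.
Qed.

Lemma enum_split (i : 'I_n) J : i \notin J ->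
  let L := [seq j : 'I_n <- enum J | (j < i)%N] in
  let R := [seq j : 'I_n <- enum J | (i < j)%N] in
  enum J = L ++ R /\ enum (i |: J) = L ++ i :: R.
Proof.
move=> iJ L R.
have sL : sorted lt_ord L by apply: (sorted_filter lt_tr); apply: sorted_enum.
have sR : sorted lt_ord R by apply: (sorted_filter lt_tr); apply: sorted_enum.
have s2: sorted lt_ord (L ++ i :: R).
  rewrite (sorted_pairwise lt_tr) pairwise_cat pairwise_cons.
  rewrite -!(sorted_pairwise lt_tr) sL sR /= andbT; apply/andP; split.
    apply/allrelP => x y; rewrite mem_filter inE => /andP[xi _].
    case/orP => [/eqP->//|]; rewrite mem_filter => /andP[iy _] /=.
    exact: ltn_trans iy.
  by apply/allP => y; rewrite mem_filter => /andP[].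
have s1: sorted lt_ord (L ++ R).
  by move: s2; apply: (subseq_sorted lt_tr); apply: cat_subseq => //; apply: subseq_cons.
have mL x : (x \in L) = (x < i)%N && (x \in J) by rewrite mem_filter mem_enum.
have mR x : (x \in R) = (i < x)%N && (x \in J) by rewrite mem_filter mem_enum.
split; apply: (irr_sorted_eq lt_tr lt_irr) => //; try exact: sorted_enum.
  move=> x; rewrite mem_cat mL mR mem_enum.
  have := iJ; have [->|ne] := eqVneq x i; first by rewrite !ltnn => /negPf->.
  by move=> _; case: (ltngtP x i) => // [_|/ord_inj E]; rewrite ?orbF //; rewrite E eqxx in ne.
move=> x; rewrite mem_cat inE mL mR mem_enum !inE.
have [->|ne] := eqVneq x i; first by rewrite orbT.
by case: (ltngtP x i) => // [_|/ord_inj E]; rewrite ?orbF //; rewrite E eqxx in ne.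
Qed.

End SortedEnum.

Section Coproduct.
Variables (k : fieldType) (n : nat).
Implicit Types (I J K : {set 'I_n}).
Section Lift.
Variables (A : lmodType k) (one : A) (op : Monoid.law one).
Hypothesis opl : forall s x y z, op (s *: x + y) z = s *: op x z + op y z.
Hypothesis opr : forall s x y z, op z (s *: x + y) = s *: op z x + op z y.
Variable f : 'I_n -> A.
Hypothesis fsq : forall i, op (f i) (f i) = 0.
Hypothesis fac : forall i j, op (f i) (f j) = - op (f j) (f i).

Lemma opA x y z : op x (op y z) = op (op x y) z. Proof. exact: Monoid.mulmA. Qed.
Lemma op0l z : op 0 z = 0.
Proof. by have := opl (-1) 0 0 z; rewrite !scaler0 addr0 scaleN1r addNr. Qed.
Lemma op0r z : op z 0 = 0.
Proof. by have := opr (-1) 0 0 z; rewrite !scaler0 addr0 scaleN1r addNr. Qed.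
Lemma opZl s x z : op (s *: x) z = s *: op x z.
Proof. by rewrite -[s *: x]addr0 opl op0l addr0. Qed.
Lemma opZr s x z : op z (s *: x) = s *: op z x.
Proof. by rewrite -[s *: x]addr0 opr op0r addr0. Qed.

Definition seqprod (s : seq 'I_n) := \big[op/one]_(j <- s) f j.
Definition mono (J : {set 'I_n}) := \big[op/one]_(i <- enum J) f i.
Lemma monoE J : mono J = seqprod (enum J). Proof. by []. Qed.
Lemma seqprod_cat s t : seqprod (s ++ t) = op (seqprod s) (seqprod t). Proof. exact: big_cat. Qed.
Lemma seqprod_cons i t : seqprod (i :: t) = op (f i) (seqprod t). Proof. exact: big_cons. Qed.
Lemma seqprod_comm i s : op (f i) (seqprod s) = (-1) ^+ size s *: op (seqprod s) (f i).
Proof.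
elim: s => [|j s IH].
  by rewrite /seqprod big_nil Monoid.mulm1 Monoid.mul1m expr0 scale1r.
rewrite seqprod_cons opA fac -scaleN1r opZl -!opA IH opZr scalerA.
by rewrite exprS.
Qed.

Lemma mono_gen i J : op (f i) (mono J) = wedge_coef k [set i] J *: mono (i |: J).
Proof.
rewrite /wedge_coef disjoints1 /inversions big_set1.
case iJ: (i \in J) => /=.
  have iD : i \notin J :\ i by rewrite !inE eqxx.
  have [_ E] := enum_split iD.
  rewrite setD1K // in E.
  rewrite monoE E seqprod_cat seqprod_cons opA seqprod_comm opZl -opA.
  by rewrite [X in op _ X]opA fsq op0l op0r scaler0 scale0r.
have [E1 E2] := enum_split (negbT iJ).
rewrite !monoE E1 E2 !seqprod_cat seqprod_cons !opA seqprod_comm opZl.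
congr (_ ^+ _ *: _).
rewrite size_filter -sum1_count big_mkcond big_enum /=.
by apply: eq_bigr => j _; case: ltnP.
Qed.

Lemma mono_mul I J : op (mono I) (mono J) = wedge_coef k I J *: mono (I :|: J).
Proof.
elim: {I}_.+1 {-2}I (ltnSn #|I|) => // m IH I Im.
case: (set_0Vmem I) => [->|[i iI]].
  by rewrite wedge_coef0l scale1r set0U /mono enum_set0 big_nil Monoid.mul1m.
have [I' iI' EI] : exists2 I' : {set 'I_n}, i \notin I' & I = i |: I'.
  by exists (I :\ i); rewrite ?inE ?eqxx // setD1K.
have cI' : (#|I'| < m)%N by move: Im; rewrite EI cardsU1 iI'.
have E1 := mono_gen i I'; rewrite -EI in E1.
have w0 : wedge_coef k [set i] I' != 0.
  by rewrite /wedge_coef disjoints1 iI' signr_eq0.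
apply: (scalerI w0); rewrite -opZl -E1 -opA IH // opZr mono_gen !scalerA.
have := wedge_coefA k [set i] I' J; rewrite -EI => <-.
by rewrite EI setUA.
Qed.

Lemma lift_mul (x y : exterior k n) :
  linext mono (wedge x y) = op (linext mono x) (linext mono y).
Proof.
elim/ffun_lin_ind: x => [|s x x' IH IH'|I].
- by rewrite /wedge twmul0l linear0 op0l.
- by rewrite /wedge twmulPl !linearP opl /= -IH -IH'.
elim/ffun_lin_ind: y => [|s x x' IH IH'|J].
- by rewrite /wedge twmul0r linear0 op0r.
- by rewrite /wedge twmulPr !linearP opr /= -IH -IH'.
by rewrite /wedge twmul_delta linearZ /= !linext_delta mono_mul.
Qed.

Lemma lift_gen i : linext mono (gen i) = f i.
Proof. by rewrite linext_delta /mono enum_set1 /= big_seq1. Qed.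
Lemma lift_1 : linext mono ext1 = one.
Proof. by rewrite linext_delta /mono enum_set0 /= big_nil. Qed.
End Lift.

Definition coprod_gen (i : 'I_n) : exterior2 k n := tens (gen i) ext1 + tens ext1 (gen i).

Lemma wedge_coef_anti (i j : 'I_n) : wedge_coef k [set i] [set j] = - wedge_coef k [set j] [set i].
Proof.
rewrite /wedge_coef !disjoints1 !inE eq_sym /inversions !big_set1.
rewrite -(inj_eq val_inj); case: ltngtP => _ /=; rewrite ?expr0 ?expr1 ?opprK ?oppr0 //.
Qed.
Lemma wedge_coef_gen2 (i : 'I_n) : wedge_coef k [set i] [set i] = 0.
Proof. by rewrite /wedge_coef disjoints1 inE eqxx. Qed.

Lemma coprod_genM i j : gmul (coprod_gen i) (coprod_gen j) =
  wedge_coef k [set i] [set j] *: (delta k ([set i] :|: [set j], set0) + delta k (set0, [set i] :|: [set j]))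
  + (delta k ([set i], [set j]) - delta k ([set j], [set i])).
Proof.
rewrite /coprod_gen /gen /ext1 !tens_delta /gmul.
rewrite -[delta k ([set i], set0)]scale1r twmulPl -[delta k ([set j], set0)]scale1r !twmulPr.
rewrite !scale1r !twmul_delta /gmul_coef /= !cards1 !cards0 !wedge_coef0l !wedge_coef0r.
rewrite !(muln0, mul0n, muln1) expr0 expr1 !(mul1r, mulr1) !set0U !setU0 !scale1r scaleN1r scalerDr.
by rewrite -!addrA; congr (_ + _); rewrite addrC -!addrA addrCA; congr (_ + _); rewrite addrC.
Qed.

Lemma gmulPl s x y z : gmul (s *: x + y) z = s *: gmul x z + gmul y z :> exterior2 k n.
Proof. exact: twmulPl. Qed.
Lemma gmulPr s x y z : gmul z (s *: x + y) = s *: gmul z x + gmul z y :> exterior2 k n.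
Proof. exact: twmulPr. Qed.

Lemma coprod_gen_anti i j : gmul (coprod_gen i) (coprod_gen j) = - gmul (coprod_gen j) (coprod_gen i).
Proof.
rewrite !coprod_genM wedge_coef_anti [[set j] :|: _]setUC opprD opprB scaleNr.
by rewrite scalerDr.
Qed.
Lemma coprod_gen_sq i : gmul (coprod_gen i) (coprod_gen i) = 0.
Proof. by rewrite coprod_genM wedge_coef_gen2 scale0r add0r subrr. Qed.

Theorem coproduct_mul (x y : exterior k n) :
  coproduct (wedge x y) = gmul (coproduct x) (coproduct y).
Proof. exact: (@lift_mul (exterior2 k n) _ (@gmul k n) gmulPl gmulPr coprod_gen coprod_gen_sq coprod_gen_anti). Qed.
Theorem coproduct_1 : coproduct ext1 = tens ext1 ext1 :> exterior2 k n.
Proof. exact: (@lift_1 (exterior2 k n) _ (@gmul k n) coprod_gen). Qed.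
Theorem coproduct_gen i : coproduct (gen i) = coprod_gen i.
Proof. exact: (@lift_gen (exterior2 k n) _ (@gmul k n) coprod_gen). Qed.
End Coproduct.

Section Embedding.
Variables (k : fieldType) (V : vectType k) (n : nat) (e : n.-tuple V).
Theorem coproduct_embed v : coproduct (embed e v) = tens (embed e v) ext1 + tens ext1 (embed e v).
Proof.
rewrite /embed {1}/coproduct linear_sum /=.
have tl : linear (fun x => tens x ext1 : exterior2 k n).
  by move=> a x y; apply/ffunP => p; rewrite !ffunE mulrDl -scalerAl.
have tr : linear (fun x => tens ext1 x : exterior2 k n).
  by move=> a x y; apply/ffunP => p; rewrite !ffunE mulrDr -scalerAr.
pose L1 : {linear exterior k n -> exterior2 k n} := HB.pack (fun x => tens x ext1 : exterior2 k n) (GRing.isLinear.Build _ _ _ _ _ tl).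
pose L2 : {linear exterior k n -> exterior2 k n} := HB.pack (fun x => tens ext1 x : exterior2 k n) (GRing.isLinear.Build _ _ _ _ _ tr).
have -> : tens (\sum_i coord e i v *: (gen i : exterior k n)) ext1 = \sum_i tens (coord e i v *: (gen i : exterior k n)) ext1 by exact: (linear_sum L1).
have -> : tens ext1 (\sum_i coord e i v *: (gen i : exterior k n)) = \sum_i tens ext1 (coord e i v *: (gen i : exterior k n)) by exact: (linear_sum L2).
rewrite -big_split /=.
apply: eq_bigr => i _; rewrite linearZ /= -/(coproduct _) coproduct_gen /coprod_gen.
by rewrite -[tens (_ *: _) _]/(L1 _) -[tens ext1 (_ *: _)]/(L2 _) !linearZ scalerDr.
Qed.
Theorem embed_sq v : wedge (embed e v) (embed e v) = 0.
Proof.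
pose g (i : 'I_n) := linext (fun b => wedge_coef k [set i] b *: delta k ([set i] :|: b)) : exterior k n -> exterior k n.
have E1 : wedge (embed e v) (embed e v) = \sum_i coord e i v *: g i (embed e v).
  rewrite /wedge twmulE {2}/embed linear_sum /=; apply: eq_bigr => i _.
  by rewrite linearZ /= linext_delta.
have E2 i : g i (embed e v) = \sum_j coord e j v *: (wedge_coef k [set i] [set j] *: delta k ([set i] :|: [set j])).
  rewrite /g /embed linear_sum /=; apply: eq_bigr => j _.
  by rewrite linearZ /= linext_delta.
rewrite E1.
pose F (i j : 'I_n) : exterior k n := (coord e i v * (coord e j v * wedge_coef k [set i] [set j])) *: delta k ([set i] :|: [set j]).
rewrite (_ : \sum_i _ = \sum_i \sum_j F i j); last first.
  by apply: eq_bigr => i _; rewrite E2 scaler_sumr; apply: eq_bigr => j _; rewrite /F !scalerA !mulrA.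
have Fac i j : F i j = - F j i.
  by rewrite /F wedge_coef_anti [[set j] :|: _]setUC -scaleNr; congr (_ *: _); ring.
have F0 i : F i i = 0 by rewrite /F wedge_coef_gen2 !mulr0 scale0r.
under eq_bigr => i _ do rewrite (bigID (fun j : 'I_n => (j <= i)%N)) /=.
rewrite big_split /=.
have -> : \sum_(i < n) \sum_(j < n | (j <= i)%N) F i j = \sum_(i < n) \sum_(j < n | (j < i)%N) F i j.
  apply: eq_bigr => i _; rewrite (bigD1 i) //= F0 add0r; apply: eq_bigl => j.
  by rewrite ltn_neqAle andbC.
rewrite [X in _ + X](exchange_big_dep xpredT) //= -big_split big1 // => i _ /=.
under [X in _ + X]eq_bigl => j do rewrite -ltnNge.
by rewrite addrC; apply/eqP; rewrite addr_eq0 -sumrN; apply/eqP/eq_bigr => j _.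
Qed.
End Embedding.

Section BilinearExtension.
Variables (k : fieldType) (V : vectType k) (n : nat) (e : n.-tuple V).
Hypothesis he : basis_of fullv e.
Implicit Types (b : V -> V -> k) (xs ys : seq V).

Definition gram b m xs ys := \det (\matrix_(i < m, j < m) b xs`_i ys`_j).

Lemma gram_tr b m xs ys : gram b m xs ys = gram (fun x y => b y x) m ys xs.
Proof. by rewrite /gram -det_tr; congr (\det _); apply/matrixP => i j; rewrite !mxE. Qed.

Definition dropat (i : nat) ys := take i ys ++ drop i.+1 ys.
Lemma nth_dropat i j ys : (i <= size ys)%N -> (dropat i ys)`_j = ys`_(bump i j).
Proof.
move=> iy; rewrite /dropat nth_cat size_takel // /bump; case: (leqP i j) => ij /=.
  by rewrite nth_drop add1n addSn subnKC.
by rewrite nth_take.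
Qed.

Lemma gram_expand b m (L R : seq V) x ys : (size L <= m)%N -> (m < size ys)%N ->
  gram b m.+1 (L ++ x :: R) ys =
  \sum_(j < m.+1) (-1) ^+ (size L + j) * b x ys`_j * gram b m (L ++ R) (dropat j ys).
Proof.
move=> Lm my; have Lm' : (size L < m.+1)%N by [].
rewrite /gram (expand_det_row _ (Ordinal Lm')); apply: eq_bigr => j _.
rewrite mxE /= nth_cat ltnn subnn /= /cofactor /= mulrCA mulrA; congr (_ * _).
congr (\det _); apply/matrixP => i l; rewrite !mxE /=; congr (b _ _).
  rewrite !nth_cat /bump; case: (leqP (size L) i) => h /=.
    by rewrite ltnNge leqW //= subSn.
  by rewrite h.
by rewrite nth_dropat // ltnW // (leq_trans (ltn_ord j)).
Qed.

Section LinearLeft.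
Variable b : V -> V -> k.
Hypothesis blin : forall s x y z, b (s *: x + y) z = s * b x z + b y z.

Definition gramext m ys (z : exterior k n) : k :=
  \sum_(I : {set 'I_n} | #|I| == m) z I * gram b m (basis_seq e I) ys.

Lemma gramextP m ys s z t : gramext m ys (s *: z + t) = s * gramext m ys z + gramext m ys t.
Proof.
rewrite /gramext mulr_sumr -big_split; apply: eq_bigr => I _.
by rewrite !ffunE mulrDl mulrA.
Qed.
Lemma gramext0 m ys : gramext m ys 0 = 0.
Proof. by rewrite /gramext big1 // => I _; rewrite ffunE mul0r. Qed.
Lemma gramextZ m ys s z : gramext m ys (s *: z) = s * gramext m ys z.
Proof. by rewrite -[_ *: _]addr0 gramextP gramext0 addr0. Qed.
Lemma gramext_delta m ys I : gramext m ys (delta k I) =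
  if #|I| == m then gram b m (basis_seq e I) ys else 0.
Proof.
rewrite /gramext; case: ifP => h; last first.
  rewrite big1 // => J /eqP hJ; rewrite ffunE; case: eqP => [E|]; rewrite ?mul0r //.
  by rewrite -E hJ eqxx in h.
rewrite (bigD1 I) //= big1 => [|J /andP[_ /negPf h']]; last by rewrite ffunE h' mul0r.
by rewrite addr0 ffunE eqxx mul1r.
Qed.

Lemma size_basis I : size (basis_seq e I) = #|I|.
Proof. by rewrite size_map -cardE. Qed.

Lemma gramext_gen m ys i z : (m < size ys)%N ->
  gramext m.+1 ys (wedge (gen i) z) =
  \sum_(j < m.+1) (-1) ^+ j * b (tnth e i) ys`_j * gramext m (dropat j ys) z.
Proof.
move=> my; elim/ffun_lin_ind: z => [|s z t IH IH'|K].
- by rewrite /wedge twmul0r gramext0 big1 // => j _; rewrite gramext0 mulr0.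
- rewrite /wedge twmulPr gramextP IH IH' mulr_sumr -big_split; apply: eq_bigr => j _ /=.
  by rewrite gramextP; ring.
rewrite /wedge twmul_delta gramextZ gramext_delta /wedge_coef disjoints1.
have -> : \sum_(j < m.+1) (-1) ^+ j * b (tnth e i) ys`_j * gramext m (dropat j ys) (delta k K)
   = if #|K| == m then gram b m.+1 (tnth e i :: basis_seq e K) ys else 0.
  case: ifP => h.
    rewrite (@gram_expand b m [::]) //; apply: eq_bigr => j _.
    by rewrite gramext_delta h add0n.
  by rewrite big1 // => j _; rewrite gramext_delta h mulr0.
case iK: (i \in K) => /=.
  rewrite mul0r; case: eqP => // cK; symmetry.
  pose a := index i (enum K).
  have ia : (a < size (enum K))%N by rewrite index_mem mem_enum.
  have ia1 : (a.+1 < m.+1)%N by rewrite ltnS -cK cardE.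
  apply: (@determinant_alternate _ _ _ ord0 (Ordinal ia1)) => // j.
  by rewrite !mxE /= (nth_map i) // nth_index // mem_enum.
have [E1 E2] := enum_split (negbT iK).
rewrite cardsU1 iK add1n eqSS; case: eqP => [cK|]; last by rewrite mulr0.
rewrite /inversions big_set1.
set L := [seq j <- _ | _] in E1 E2; set R := [seq j <- _ | _] in E1 E2.
have -> : (\sum_(j in K) (j < i))%N = size L.
  rewrite size_filter -sum1_count -[LHS]big_enum /= [RHS]big_mkcond /=.
  by apply: eq_bigr => j _; case: ltnP.
have sz : (size L <= m)%N by rewrite -cK cardE E1 size_cat leq_addr.
have -> : basis_seq e (i |: K) = map (tnth e) L ++ tnth e i :: map (tnth e) R.
  by rewrite /basis_seq /image_mem E2 map_cat.
have -> : basis_seq e K = map (tnth e) L ++ map (tnth e) R.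
  by rewrite /basis_seq /image_mem E1 map_cat.
rewrite gram_expand ?size_map // (@gram_expand b m [::]) // mulr_sumr.
apply: eq_bigr => j _; rewrite exprD !mulrA -expr2 sqrr_sign mul1r add0n //.
Qed.

Lemma wedge_embed x z : wedge (embed e x) z = \sum_i coord e i x *: wedge (gen i) z.
Proof.
rewrite /wedge twmulE /embed linear_sum; apply: eq_bigr => i _.
by rewrite linearZ /= -twmulE.
Qed.

Lemma b0l z : b 0 z = 0.
Proof. by have := blin (-1) 0 0 z; rewrite scaler0 addr0 mulN1r addNr. Qed.

Lemma gramext_embed m ys x z : (m < size ys)%N ->
  gramext m.+1 ys (wedge (embed e x) z) =
  \sum_(j < m.+1) (-1) ^+ j * b x ys`_j * gramext m (dropat j ys) z.
Proof.
move=> my.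
have bs w : b x w = \sum_i coord e i x * b (tnth e i) w.
  rewrite {1}(coord_basis he (memvf x)).
  have -> (F : 'I_n -> k) : b (\sum_i F i *: e`_i) w = \sum_i F i * b e`_i w.
    by apply: (big_rec2 (fun u v => b u w = v)) => [|i y1 y2 _ <-]; rewrite ?b0l ?blin.
  by apply: eq_bigr => i _; rewrite (tnth_nth 0).
have Hs (F : 'I_n -> exterior k n) : gramext m.+1 ys (\sum_i F i) = \sum_i gramext m.+1 ys (F i).
  apply: (big_morph (gramext m.+1 ys)) => [u v|]; last exact: gramext0.
  by rewrite -[u]scale1r gramextP mul1r scale1r.
rewrite wedge_embed Hs.
under eq_bigr => i _ do rewrite gramextZ gramext_gen // mulr_sumr.
rewrite exchange_big; apply: eq_bigr => j _ /=.
rewrite bs [_ * \sum_i _]mulr_sumr mulr_suml; apply: eq_bigr => i _; ring.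
Qed.

Definition wprod (xs : seq V) : exterior k n := \big[@wedge k n/ext1]_(x <- xs) embed e x.

Lemma size_dropat j ys : (j < size ys)%N -> size (dropat j ys) = (size ys).-1.
Proof. by move=> h; rewrite size_cat size_takel 1?ltnW // size_drop -[in RHS](subnKC h). Qed.

Lemma gramext_wprod xs ys : (size xs <= size ys)%N ->
  gramext (size xs) ys (wprod xs) = gram b (size xs) xs ys.
Proof.
elim: xs ys => [|x xs IH] ys sz.
  by rewrite /wprod big_nil gramext_delta cards0 /gram !det_mx00.
rewrite /wprod big_cons -/(wprod xs) gramext_embed // (@gram_expand b (size xs) [::]) //.
apply: eq_bigr => j _; rewrite IH ?add0n //.
have js : (j < size ys)%N := leq_trans (ltn_ord j) sz.
by rewrite size_dropat // -ltnS prednK // (leq_ltn_trans _ js).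
Qed.

Lemma wprod_deg xs I : wprod xs I != 0 -> #|I| = size xs.
Proof.
elim: xs I => [|x xs IH] I.
  by rewrite /wprod big_nil ffunE; have [->|_] := eqVneq I set0; rewrite ?cards0 ?eqxx.
rewrite /wprod big_cons -/(wprod xs) wedge_embed sum_ffunE => H.
case: (pickP (fun i => wedge (gen i) (wprod xs) I != 0)) => [i|/= h]; last first.
  by rewrite big1 ?eqxx // in H => i _; rewrite ffunE (eqP (negbFE (h i))) scaler0.
rewrite /wedge twmulE linext_delta /linext sum_ffunE => H2.
case: (pickP (fun J => (wprod xs J != 0) && (wedge_coef k [set i] J != 0) && (I == i |: J))) => [J|/= h].
  case/andP => /andP[/IH /= <-]; rewrite /wedge_coef disjoints1.
  by case iJ : (i \in J) => /=; rewrite ?eqxx // => _ /eqP ->; rewrite cardsU1 iJ.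
rewrite big1 ?eqxx // in H2 => J _; rewrite !ffunE.
move: (h J); case: eqP => [-> _|_]; first by rewrite scale0r.
case: eqP => [-> _|_]; first by rewrite scale0r scaler0.
by rewrite /= => ->; rewrite !scaler0.
Qed.
End LinearLeft.

Variable B : {biscalar V}.

Theorem Bwedge_wprod xs ys : Bwedge e B (wprod xs) (wprod ys) = Bwedge_dec B xs ys.
Proof.
pose sg (r : nat) : k := (-1) ^+ ((r * r.-1) %/ 2).
rewrite /Bwedge /Bwedge_dec; case: eqP => [sE|sN]; last first.
  rewrite big1 // => I _; rewrite big1 // => J _.
  have [->|/wprod_deg cI] := eqVneq (wprod xs I) 0; first by rewrite !mul0r.
  have [->|/wprod_deg cJ] := eqVneq (wprod ys J) 0; first by rewrite mulr0 mul0r.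
  by rewrite !size_basis cI cJ; case: eqP => // _; rewrite mulr0.
rewrite -/(sg _) -/(gram (fun x y => B x y) _ xs ys).
have Hl : forall s x y z, B (s *: x + y) z = s * B x z + B y z.
  by move=> s x y z; rewrite linearPl.
have Hr : forall s x y z, B z (s *: x + y) = s * B z x + B z y.
  by move=> s x y z; rewrite linearPr.
rewrite -(gramext_wprod Hl) ?sE // /gramext mulr_sumr [RHS]big_mkcond; apply: eq_bigr => I _.
case: ifP => [/eqP cI|cI]; last first.
  rewrite big1 // => J _; have [->|/wprod_deg E] := eqVneq (wprod xs I) 0; first by rewrite !mul0r.
  by rewrite E sE eqxx in cI.
rewrite gram_tr -(gramext_wprod Hr) ?size_basis ?cI // /gramext mulr_sumr mulr_sumr [RHS]big_mkcond.
apply: eq_bigr => J _; rewrite !size_basis eq_sym; case: eqP => [cJ|cJ]; last first.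
  by rewrite !mulr0.
rewrite gram_tr -/(sg _) -/(gram (fun x y => B x y) _ (basis_seq e I) _).
by ring.
Qed.
End BilinearExtension.

End GrassmannFacts.

(* Main.v *)
Require Import Defs.
From mathcomp Require Import all_boot all_order all_algebra.
From mathcomp Require Import ring.

(** The counit [eps] is not multiplicative for a Clifford product unless the
form vanishes: [eps (e_i &c e_j)] is the value of the form at [(e_i, e_j)],
whereas [eps e_i = 0].  On the other hand a right cointegral [c] forces [eps]
to be multiplicative up to [c], because by associativity
[eps (x &c y) c = (x &c y) &c c = x &c (y &c c) = eps x eps y c].
With [x = e_i] and [y = e_j], every entry of the Gram matrix of the form
annihilates [c], so a nonzero form leaves only [c = 0]; left cointegrals are
symmetric.  This is [cl2_right_cointegral_eq0] and [cl2_left_cointegral_eq0].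

The statement on integrals is the same one in the dual space.  The convolution
[f * g = (f (x) g) o Delta_C] dual to the Clifford co-product is again a Clifford
product, for the form whose Gram matrix is [C], and an integral is exactly a
cointegral of that dual algebra: pairing [(id (x) mu) Delta_C = mu 1] with [f]
gives [f * mu = f(1) mu], and [f |-> f(1)] is the counit of the dual.

Both halves thus reduce to one algebra, the Clifford algebra [cl2 M] of a 2 x 2
matrix written in coordinates.  The work lies in identifying it with the given
product ([clifford_mul_cl2], [M] the Gram matrix of [B]) and with the dual of
the given co-product ([clifford_coproduct_dual], [M = C]). *)

Import GRing.Theory GrassmannFacts.
Local Open Scope ring_scope.

Set Implicit Arguments.
Unset Strict Implicit.
Unset Printing Implicit Defensive.

Local Notation i0 := (ord0 : 'I_2).
Local Notation i1 := (ord_max : 'I_2).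
Local Notation s0 := (set0 : {set 'I_2}).
Local Notation s1 := [set i0].
Local Notation s2 := [set i1].
Local Notation s12 := [set: 'I_2].

(** * Subsets of a two-element set *)

Lemma ord2P (i : 'I_2) : (i == i0) || (i == i1).
Proof. by case: i => [[|[|]]]. Qed.

(** Reduces equality of concrete subsets to membership, which computes. *)
Lemma eq_set2 (I J : {set 'I_2}) :
  (I == J) = ((i0 \in I) == (i0 \in J)) && ((i1 \in I) == (i1 \in J)).
Proof.
apply/eqP/andP => [-> //|[/eqP h0 /eqP h1]].
by apply/setP => i; case/orP: (ord2P i) => /eqP ->.
Qed.

(** Elimination principle for proving identities in the exterior algebra one
coordinate at a time. *)
Lemma set_ord2_ind (P : {set 'I_2} -> Prop) : P s0 -> P s1 -> P s2 -> P s12 -> forall I, P I.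
Proof.
move=> P0 P1 P2 P12 I.
have : [|| I == s0, I == s1, I == s2 | I == s12].
  by rewrite !eq_set2 !inE /=; case: (i0 \in I); case: (i1 \in I).
by case/or4P => /eqP ->.
Qed.

(** * The Clifford algebra of a 2 x 2 matrix *)

Section Model.
Variable k : fieldType.
Implicit Types (x y z c : exterior k 2) (M : 'M[k]_2).

Definition ext4 (a0 a1 a2 a12 : k) : exterior k 2 :=
  [ffun I : {set 'I_2} => if i0 \in I then (if i1 \in I then a12 else a1)
                          else (if i1 \in I then a2 else a0)].

Lemma ext4E a0 a1 a2 a12 (u := ext4 a0 a1 a2 a12) :
  ((u s0 = a0) * (u s1 = a1) * (u s2 = a2) * (u s12 = a12)).
Proof. by rewrite /u !ffunE !inE. Qed.

Lemma delta4 : ((delta k s0 = ext4 1 0 0 0) * (delta k s1 = ext4 0 1 0 0) *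
  (delta k s2 = ext4 0 0 1 0) * (delta k s12 = ext4 0 0 0 1)).
Proof.
by do !split; apply/ffunP; elim/set_ord2_ind; rewrite ext4E !ffunE eq_set2 !inE.
Qed.

(** The coordinates of the Clifford product of [x] and [y] when [M] is the Gram
matrix of the form, multiplied out from [e_i e_j = e_i /\ e_j + M i j],
[e_i e_12 = M i 0 e_1 - M i 1 e_0], [e_12 e_j = M 1 j e_0 - M 0 j e_1] and
[e_12 e_12 = - \det M + (M 1 0 - M 0 1) e_12], where [e_12 = e_0 /\ e_1]. *)
Definition cl2 M x y : exterior k 2 :=
  ext4
    (x s0 * y s0 + x s1 * y s1 * M i0 i0 + x s1 * y s2 * M i0 i1
     + x s2 * y s1 * M i1 i0 + x s2 * y s2 * M i1 i1
     + x s12 * y s12 * (M i0 i1 * M i1 i0 - M i0 i0 * M i1 i1))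
    (x s0 * y s1 + x s1 * y s0 - (x s1 * M i0 i1 + x s2 * M i1 i1) * y s12
     + x s12 * (y s1 * M i1 i0 + y s2 * M i1 i1))
    (x s0 * y s2 + x s2 * y s0 + (x s1 * M i0 i0 + x s2 * M i1 i0) * y s12
     - x s12 * (y s1 * M i0 i0 + y s2 * M i0 i1))
    (x s0 * y s12 + x s12 * y s0 + x s1 * y s2 - x s2 * y s1
     + x s12 * y s12 * (M i1 i0 - M i0 i1)).

Lemma cl2A M : associative (cl2 M).
Proof.
move=> x y z; apply/ffunP; elim/set_ord2_ind; rewrite /cl2 !ext4E; ring.
Qed.

Lemma counit_cl2_gen M i j : counit (cl2 M (gen i) (gen j)) = M i j.
Proof.
by case/orP: (ord2P i) => /eqP ->; case/orP: (ord2P j) => /eqP ->;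
  rewrite /counit /gen !delta4 /cl2 !ext4E; ring.
Qed.

Lemma counit_gen i : counit (gen i : exterior k 2) = 0.
Proof. by case/orP: (ord2P i) => /eqP ->; rewrite /counit /gen !delta4 ext4E. Qed.

Lemma cl20r M x : cl2 M x 0 = 0.
Proof. by apply/ffunP; elim/set_ord2_ind; rewrite /cl2 ext4E !ffunE; ring. Qed.
Lemma cl20l M x : cl2 M 0 x = 0.
Proof. by apply/ffunP; elim/set_ord2_ind; rewrite /cl2 ext4E !ffunE; ring. Qed.

Lemma entries_annihilate_eq0 M c : M != 0 -> (forall i j, M i j *: c = 0) -> c = 0.
Proof.
move=> M0 h; apply: contraNeq M0 => c0; apply/eqP/matrixP => i j; rewrite mxE.
by apply/eqP; move/eqP: (h i j); rewrite scaler_eq0 (negPf c0) orbF.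
Qed.

(** By associativity [counit (x y) c = counit x *: (counit y *: c)]; taking
generators for [x] and [y] shows that the entries of [M] annihilate [c]. *)
Lemma cl2_right_cointegral_eq0 M c : M != 0 -> (forall x, cl2 M x c = counit x *: c) -> c = 0.
Proof.
move=> M0 h; apply: (entries_annihilate_eq0 M0) => i j.
by rewrite -counit_cl2_gen -h -cl2A h counit_gen scale0r cl20r.
Qed.

Lemma cl2_left_cointegral_eq0 M c : M != 0 -> (forall x, cl2 M c x = counit x *: c) -> c = 0.
Proof.
move=> M0 h; apply: (entries_annihilate_eq0 M0) => i j.
by rewrite -counit_cl2_gen -h cl2A h counit_gen scale0r cl20l.
Qed.

End Model.

(** * Products and co-products of the basis *)

Section Basis.
Variable k : fieldType.
Implicit Types x u : exterior k 2.

Lemma wedge_units x : (wedge (delta k s0) x = x) * (wedge x (delta k s0) = x).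
Proof. by split; [apply: wedge1x|apply: wedgex1]. Qed.

Lemma wedge_gens :
  ((wedge (delta k s1) (delta k s2) = delta k s12) *
   (wedge (delta k s2) (delta k s1) = - delta k s12)).
Proof.
have U : s1 :|: s2 = s12 by apply/eqP; rewrite eq_set2 !inE.
rewrite /wedge !twmul_delta [s2 :|: _]setUC U /wedge_coef !disjoints1 !inE /=.
by rewrite /inversions !big_set1 /= expr0 expr1 scale1r scaleN1r.
Qed.

Lemma wedge_overlap (I J : {set 'I_2}) : ~~ [disjoint I & J] ->
  wedge (delta k I) (delta k J) = 0.
Proof. by move=> /negPf d; rewrite /wedge twmul_delta /wedge_coef d scale0r. Qed.

Lemma wedge_table :
  ((wedge (delta k s1) (delta k s1) = 0) * (wedge (delta k s2) (delta k s2) = 0)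
  * (wedge (delta k s1) (delta k s12) = 0) * (wedge (delta k s2) (delta k s12) = 0)
  * (wedge (delta k s12) (delta k s1) = 0) * (wedge (delta k s12) (delta k s2) = 0)
  * (wedge (delta k s12) (delta k s12) = 0)).
Proof.
have ne i (I J : {set 'I_2}) : i \in I -> i \in J -> wedge (delta k I) (delta k J) = 0.
  by move=> iI iJ; apply: wedge_overlap; apply/pred0Pn; exists i; rewrite /= iI.
by do !split; first [by apply: (ne i0); rewrite !inE | by apply: (ne i1); rewrite !inE].
Qed.

Lemma coproduct_basis :
  ((coproduct (delta k s0) = delta k (s0, s0)) *
   (coproduct (delta k s1) = delta k (s1, s0) + delta k (s0, s1)) *
   (coproduct (delta k s2) = delta k (s2, s0) + delta k (s0, s2)) *
   (coproduct (delta k s12) =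
     delta k (s12, s0) + delta k (s1, s2) - delta k (s2, s1) + delta k (s0, s12))).
Proof.
have E0 : coproduct (delta k s0) = delta k (s0, s0).
  by rewrite [LHS]coproduct_1 tens_delta.
have Eg i : coproduct (delta k [set i]) = delta k ([set i], s0) + delta k (s0, [set i]).
  by rewrite [LHS]coproduct_gen /coprod_gen !tens_delta.
do !split => //.
rewrite -wedge_gens.1 coproduct_mul !coproduct_gen coprod_genM.
have U : s1 :|: s2 = s12 by apply/eqP; rewrite eq_set2 !inE.
rewrite U /wedge_coef disjoints1 inE /inversions !big_set1 /= expr0 scale1r.
by rewrite addrAC addrA.
Qed.

Lemma delta_decomp x :
  x = x s0 *: (delta k s0 : exterior k 2) + x s1 *: (delta k s1 : exterior k 2)
  + x s2 *: (delta k s2 : exterior k 2) + x s12 *: (delta k s12 : exterior k 2).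
Proof.
apply/ffunP; elim/set_ord2_ind; rewrite !delta4 !ffunE !inE /= /GRing.scale /=; ring.
Qed.

Lemma coproductE x : coproduct x =
  x s0 *: coproduct (delta k s0) + x s1 *: coproduct (delta k s1)
  + x s2 *: coproduct (delta k s2) + x s12 *: coproduct (delta k s12).
Proof. by rewrite {1}[x]delta_decomp /coproduct !linearD !linearZ. Qed.

Lemma wedge_basis u :
  ((wedge (delta k s0) u = u) * (wedge (delta k s1) u = ext4 0 (u s0) 0 (u s2)) *
   (wedge (delta k s2) u = ext4 0 0 (u s0) (- u s1)) *
   (wedge (delta k s12) u = ext4 0 0 0 (u s0))).
Proof.
have D (x y z : exterior k 2) : wedge x (y + z) = wedge x y + wedge x z.
  by rewrite -[y]scale1r [LHS]twmulPr !scale1r.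
have E I : wedge (delta k I) u = u s0 *: wedge (delta k I) (delta k s0)
    + u s1 *: wedge (delta k I) (delta k s1) + u s2 *: wedge (delta k I) (delta k s2)
    + u s12 *: wedge (delta k I) (delta k s12).
  by rewrite {1}[u]delta_decomp !D /wedge !twmulZr.
split; first split; first (split; first by rewrite wedge_units).
all: rewrite E !wedge_units ?wedge_gens ?wedge_table.
all: apply/ffunP; elim/set_ord2_ind; rewrite ?delta4 !ffunE !inE /= /GRing.scale /=; ring.
Qed.

End Basis.

(** * Linear extensions *)

Section Linext.
Variables (k : fieldType) (T : finType) (W : lmodType k) (G : T -> W).
Implicit Types X Y : {ffun T -> k^o}.

Lemma linextD X Y : linext G (X + Y) = linext G X + linext G Y.
Proof. exact: linearD. Qed.
Lemma linextN X : linext G (- X) = - linext G X.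
Proof. exact: linearN. Qed.
Lemma linextZ a X : linext G (a *: X) = a *: linext G X.
Proof. exact: linearZ. Qed.
End Linext.

Lemma linext_comp (k : fieldType) (T U : finType) (W : lmodType k)
    (G : U -> W) (F : T -> {ffun U -> k^o}) X :
  linext G (linext F X) = linext (fun t => linext G (F t)) X.
Proof. by rewrite [X in linext G X]/linext linear_sum; apply: eq_bigr => t _; rewrite linearZ. Qed.

Lemma wedge_linext (k : fieldType) (n : nat) (T : finType) (F : T -> exterior k n)
    (z : exterior k n) X :
  wedge z (linext F X) = linext (fun t => wedge z (F t)) X.
Proof.
rewrite /linext.
apply: (big_rec2 (fun u v => wedge z u = v)) => [|t u v _ <-].
  exact: twmul0r.
exact: twmulPr.
Qed.

Lemma linext_coproduct (k : fieldType) (W : lmodType k)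
    (G : {set 'I_2} * {set 'I_2} -> W) (x : exterior k 2) :
  linext G (coproduct x) =
    x s0 *: G (s0, s0) + x s1 *: (G (s1, s0) + G (s0, s1))
    + x s2 *: (G (s2, s0) + G (s0, s2))
    + x s12 *: (G (s12, s0) + G (s1, s2) - G (s2, s1) + G (s0, s12)).
Proof.
(* Linearity with the summands kept abstract, so that they are matched by their
   position and distinct basis vectors are never compared. *)
pose L X g := linext G X = g.
have L9 X0 X1 X2 X3 X4 X5 X6 X7 X8 g0 g1 g2 g3 g4 g5 g6 g7 g8 a b c d :
    L X0 g0 -> L X1 g1 -> L X2 g2 -> L X3 g3 -> L X4 g4 -> L X5 g5 -> L X6 g6 ->
    L X7 g7 -> L X8 g8 ->
  L (a *: X0 + b *: (X1 + X2) + c *: (X3 + X4) + d *: (X5 + X6 - X7 + X8))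
    (a *: g0 + b *: (g1 + g2) + c *: (g3 + g4) + d *: (g5 + g6 - g7 + g8)).
  by rewrite /L => <- <- <- <- <- <- <- <- <-; rewrite !(linextD, linextZ, linextN).
rewrite coproductE !coproduct_basis; apply: L9; exact: linext_delta.
Qed.

(** * The Clifford product *)

Section Product.
Variables (k : fieldType) (V : vectType k) (e : 2.-tuple V) (B : {biscalar V}).
Implicit Types x y : exterior k 2.

Definition gram_mx : 'M[k]_2 := \matrix_(i, j) B (tnth e i) (tnth e j).

Lemma Bwedge_delta I J :
  Bwedge e B (delta k I) (delta k J) = Bwedge_dec B (basis_seq e I) (basis_seq e J).
Proof.
rewrite /Bwedge (bigD1 I) //= [X in _ + X]big1 => [|I' /negPf nI]; last first.
  by rewrite big1 // => J' _; rewrite !ffunE nI !mul0r.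
rewrite addr0 (bigD1 J) //= big1 => [|J' /negPf nJ]; last first.
  by rewrite !ffunE nJ mulr0 mul0r.
by rewrite addr0 !ffunE !eqxx !mul1r.
Qed.

Lemma Bwedge_grade (I J : {set 'I_2}) : #|I| != #|J| -> Bwedge e B (delta k I) (delta k J) = 0.
Proof. by move=> /negPf h; rewrite Bwedge_delta /Bwedge_dec !size_basis h. Qed.

Lemma Bwedge0 : Bwedge e B (delta k s0) (delta k s0) = 1.
Proof.
by rewrite Bwedge_delta /Bwedge_dec !size_basis eqxx !cards0 det_mx00 expr0 mul1r.
Qed.

Lemma Bwedge1 i j : Bwedge e B (delta k [set i]) (delta k [set j]) = gram_mx i j.
Proof.
rewrite Bwedge_delta /Bwedge_dec /basis_seq /image_mem !enum_set1 /=.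
by rewrite det_mx11 !mxE expr0 mul1r.
Qed.

Lemma Bwedge2 : Bwedge e B (delta k s12) (delta k s12) =
  gram_mx i0 i1 * gram_mx i1 i0 - gram_mx i0 i0 * gram_mx i1 i1.
Proof.
have E : basis_seq e s12 = [:: tnth e i0; tnth e i1].
  rewrite /basis_seq /image_mem (_ : enum _ = [:: i0; i1]) //.
  by rewrite enum_setT -enumT; apply: (inj_map val_inj); rewrite val_enum_ord.
rewrite Bwedge_delta E /Bwedge_dec /= expr1 (expand_det_row _ i0).
rewrite !big_ord_recl big_ord0 /cofactor !det_mx11 !mxE /=.
rewrite expr0 expr1; ring.
Qed.

Lemma Bwedge_table :
  ((Bwedge e B (delta k s0) (delta k s1) = 0) * (Bwedge e B (delta k s0) (delta k s2) = 0) *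
   (Bwedge e B (delta k s0) (delta k s12) = 0) * (Bwedge e B (delta k s1) (delta k s0) = 0) *
   (Bwedge e B (delta k s2) (delta k s0) = 0) * (Bwedge e B (delta k s12) (delta k s0) = 0) *
   (Bwedge e B (delta k s1) (delta k s12) = 0) * (Bwedge e B (delta k s2) (delta k s12) = 0) *
   (Bwedge e B (delta k s12) (delta k s1) = 0) * (Bwedge e B (delta k s12) (delta k s2) = 0)).
Proof.
by do !split; rewrite Bwedge_grade // !(cards0, cards1, cardsT, card_ord).
Qed.

(** Contraction of [y] by the multivector [delta J], so that the Clifford product
of [x] and [y] is the sum of the [x_(1) /\ contract x_(2) y]. *)
Definition contract (J : {set 'I_2}) y : exterior k 2 :=
  linext (fun q => Bwedge e B (delta k J) (delta k q.1) *: (delta k q.2 : exterior k 2))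
    (coproduct y).

Lemma contractE y :
  ((contract s0 y = y) *
   (contract s1 y = ext4 (y s1 * gram_mx i0 i0 + y s2 * gram_mx i0 i1)
      (- (y s12 * gram_mx i0 i1)) (y s12 * gram_mx i0 i0) 0) *
   (contract s2 y = ext4 (y s1 * gram_mx i1 i0 + y s2 * gram_mx i1 i1)
      (- (y s12 * gram_mx i1 i1)) (y s12 * gram_mx i1 i0) 0) *
   (contract s12 y = ext4 (y s12 * (gram_mx i0 i1 * gram_mx i1 i0
      - gram_mx i0 i0 * gram_mx i1 i1)) 0 0 0)).
Proof.
have bE := (Bwedge_table, Bwedge0, Bwedge1, Bwedge2).
have E J I : contract J y I =
    y s0 * (Bwedge e B (delta k J) (delta k s0) * delta k s0 I)
  + y s1 * (Bwedge e B (delta k J) (delta k s1) * delta k s0 I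
      + Bwedge e B (delta k J) (delta k s0) * delta k s1 I)
  + y s2 * (Bwedge e B (delta k J) (delta k s2) * delta k s0 I
      + Bwedge e B (delta k J) (delta k s0) * delta k s2 I)
  + y s12 * (Bwedge e B (delta k J) (delta k s12) * delta k s0 I
      + Bwedge e B (delta k J) (delta k s1) * delta k s2 I
      - Bwedge e B (delta k J) (delta k s2) * delta k s1 I
      + Bwedge e B (delta k J) (delta k s0) * delta k s12 I).
  by rewrite /contract linext_coproduct /= !ffunE.
do !split; apply/ffunP; elim/set_ord2_ind; rewrite E !bE !delta4 !ext4E; ring.
Qed.

Lemma clifford_mul_cl2 x y : clifford_mul e B x y = cl2 gram_mx x y.
Proof.
have -> : clifford_mul e B x y =
    linext (fun p => wedge (delta k p.1) (contract p.2 y)) (coproduct x).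
  apply: eq_bigr => p _; rewrite wedge_linext scaler_sumr.
  apply: eq_bigr => q _.
  by rewrite /wedge twmulZr !scalerA.
rewrite linext_coproduct /= !contractE !wedge_basis.
apply/ffunP; elim/set_ord2_ind; rewrite !ffunE !inE /= /GRing.scale /=.
all: ring.
Qed.

Lemma gram_mx_neq0 : basis_of {:V} e -> (exists v w : V, B v w != 0) -> gram_mx != 0.
Proof.
move=> he [v [w]]; apply: contraNneq => G0.
rewrite (coord_basis he (memvf v)) linear_sumlz big1 // => i _.
rewrite linearZl_LR /= (coord_basis he (memvf w)) linear_sumr big1 => [|j _]; first exact: mulr0.
rewrite linearZr /= -!tnth_nth.
by have := congr1 (fun M : 'M[k]_2 => M i j) G0; rewrite !mxE => ->; exact: mulr0.
Qed.

End Product.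

(** * The convolution product dual to the Clifford co-product *)

Section Coproduct.
Variables (k : fieldType) (C : 'M[k]_2).
Implicit Types x y : exterior k 2.

Definition pairing x y (X : exterior2 k 2) : k^o :=
  linext (fun p => x p.1 * y p.2 : k^o) X.

Definition dual_coords (mu : exterior k 2 -> k) : exterior k 2 := [ffun I => mu (delta k I)].

Lemma pairing_tens x y a b :
  pairing x y (tens a b) = linext (x : _ -> k^o) a * linext (y : _ -> k^o) b.
Proof.
rewrite /pairing /linext mulr_suml.
under [RHS]eq_bigr => I _ do rewrite mulr_sumr.
rewrite pair_bigA /=; apply: eq_bigr => p _.
by rewrite ffunE /GRing.scale /=; ring.
Qed.

Lemma pairing_id_tens x mu X : pairing x (dual_coords mu) X = linext (x : _ -> k^o) (id_tens mu X).
Proof.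
rewrite /id_tens linext_comp; apply: eq_bigr => p _.
by rewrite linextZ linext_delta ffunE /GRing.scale /=; ring.
Qed.

Lemma pairing_tens_id x mu X : pairing (dual_coords mu) x X = linext (x : _ -> k^o) (tens_id mu X).
Proof.
rewrite /tens_id linext_comp; apply: eq_bigr => p _.
by rewrite linextZ linext_delta ffunE /GRing.scale /=; ring.
Qed.

Lemma linext_Cwedge (W : lmodType k) (G : {set 'I_2} * {set 'I_2} -> W) :
  linext G (Cwedge C) = G (s0, s0) + C i0 i0 *: G (s1, s1) + C i0 i1 *: G (s1, s2)
    + C i1 i0 *: G (s2, s1) + C i1 i1 *: G (s2, s2)
    + (C i0 i1 * C i1 i0 - C i0 i0 * C i1 i1) *: G (s12, s12).
Proof.
have l1 : lift i0 (ord0 : 'I_1) = i1 by apply: val_inj.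
rewrite /Cwedge !big_ord_recl !big_ord0 !addr0 l1 /gen !wedge_gens !tens_delta.
pose L X g := linext G X = g.
have L6 X0 X1 X2 X3 X4 X5 g0 g1 g2 g3 g4 g5 a b c d f :
    L X0 g0 -> L X1 g1 -> L X2 g2 -> L X3 g3 -> L X4 g4 -> L X5 g5 ->
  L (X0 + (a *: X1 + b *: X2 + (c *: X3 + d *: X4)) + f *: X5)
    (g0 + a *: g1 + b *: g2 + c *: g3 + d *: g4 + f *: g5).
  by rewrite /L => <- <- <- <- <- <-; rewrite !(linextD, linextZ) !addrA.
apply: L6; exact: linext_delta.
Qed.

(** In coordinates, [x] and [y] stand for linear forms; their convolution has value
[cl2 C x y I] at [delta I], so [cl2 C] is the product of the dual algebra. *)
Lemma clifford_coproduct_dual x y I :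
  pairing x y (clifford_coproduct C (delta k I)) = cl2 C x y I.
Proof.
(* [ev z J L] is the value of the linear form [z] at [delta J /\ delta L]. *)
pose ev (z : exterior k 2) J L : k := linext (z : _ -> k^o) (wedge (delta k J) (delta k L)).
pose F (p q : {set 'I_2} * {set 'I_2}) : k^o := ev x p.1 q.1 * ev y q.2 p.2.
have -> : pairing x y (clifford_coproduct C (delta k I)) =
    linext (fun p => linext (F p) (Cwedge C)) (coproduct (delta k I)).
  rewrite /pairing linear_sum; apply: eq_bigr => p _.
  rewrite linear_sum [X in _ = _ *: X]/linext scaler_sumr; apply: eq_bigr => q _ /=.
  by rewrite linextZ [linext _ _]pairing_tens [RHS]scalerA.
have ev0 z J : (ev z s0 J = z J) * (ev z J s0 = z J).
  by rewrite /ev !wedge_units !linext_delta.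
have ev12 z : (ev z s1 s2 = z s12) * (ev z s2 s1 = - z s12).
  by rewrite /ev !wedge_gens linextN !linext_delta.
have evz z : (ev z s1 s1 = 0) * (ev z s2 s2 = 0) * (ev z s1 s12 = 0) * (ev z s2 s12 = 0)
   * (ev z s12 s1 = 0) * (ev z s12 s2 = 0) * (ev z s12 s12 = 0).
  by rewrite /ev !wedge_table linear0.
rewrite linext_coproduct.
elim/set_ord2_ind: I; rewrite !delta4 !ext4E !scale0r ?add0r ?addr0 scale1r.
all: rewrite !linext_Cwedge /F /= !ev0 ?evz ?ev12 /GRing.scale /=; ring.
Qed.

(** Pairing the integral equation with the linear form [x], whose value at 1 is
[counit x], turns it into the cointegral equation of the dual algebra. *)
Lemma right_integral_dual mu : right_integral C mu ->
  forall x, cl2 C x (dual_coords mu) = counit x *: dual_coords mu.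
Proof.
move=> h x; apply/ffunP => I; rewrite -clifford_coproduct_dual pairing_id_tens h.
by rewrite linextZ linext_delta !ffunE /GRing.scale /= mulrC.
Qed.

Lemma left_integral_dual mu : left_integral C mu ->
  forall x, cl2 C (dual_coords mu) x = counit x *: dual_coords mu.
Proof.
move=> h x; apply/ffunP => I; rewrite -clifford_coproduct_dual pairing_tens_id h.
by rewrite linextZ linext_delta !ffunE /GRing.scale /= mulrC.
Qed.

Lemma dual_coords_eq0 (mu : {scalar exterior k 2}) : dual_coords mu = 0 -> forall x, mu x = 0.
Proof.
move=> h x; rewrite -[x]linext_id linear_sum big1 // => I _.
by rewrite linearZ /= -[mu _](ffunE (fun I => mu (delta k I))) -/(dual_coords mu) h ffunE mulr0.
Qed.

End Coproduct.

(** * Integrals and cointegrals *)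

Theorem theorem6p4 (k : fieldType) (V : vectType k) (hV : \dim {:V} = 2%N)
    (e : 2.-tuple V) (he : basis_of {:V} e) (B : {biscalar V}) (C : 'M[k]_2) :
  (C != 0 ->
     ~ (exists mu : {scalar exterior k 2},
          (exists x, mu x != 0) /\ (right_integral C mu \/ left_integral C mu)))
  /\
  ((exists v w : V, B v w != 0) ->
     ~ (exists c : exterior k 2,
          c != 0 /\ (right_cointegral e B c \/ left_cointegral e B c))).
Proof.
split=> [C0 [mu [[x /negP mux]]] int|B0 [c [/negP c0 coint]]].
  apply/mux/eqP/dual_coords_eq0.
  case: int => [/right_integral_dual|/left_integral_dual].
    exact: cl2_right_cointegral_eq0.
  exact: cl2_left_cointegral_eq0.
apply/c0/eqP; have G0 := gram_mx_neq0 he B0.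
case: coint => h.
  by apply: (cl2_right_cointegral_eq0 G0) => x; rewrite -clifford_mul_cl2 h.
by apply: (cl2_left_cointegral_eq0 G0) => x; rewrite -clifford_mul_cl2 h.
Qed.
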